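(* Let $S$ be a $\mathrm{Cu}$-semigroup that is approximated by a family $(S_\lambda,\varphi_\lambda)_{\lambda\in\Lambda}$ of $\mathrm{Cu}$-semigroups $S_\lambda$ and $\mathrm{Cu}$-morphisms $\varphi_\lambda\colon S_\lambda\to S$. Then $\dim(S)\leq\sup_{\lambda\in\Lambda}\dim(S_\lambda)$.
   Context: Way-below relation: in a partially ordered set, $x\ll y$ means that for every increasing sequence $(z_n)_n$ that has a supremum $z$ with $y\leq z$ there exists $n$ with $x\leq z_n$. A $\mathrm{Cu}$-semigroup is an abelian monoid $S$ with a partial order such that $0\leq x$ for all $x$, and $x\leq y$ implies $x+z\leq y+z$, satisfying: (O1) every increasing sequence has a supremum; (O2) every element is the supremum of a $\ll$-increasing sequence (i.e. $x_n\ll x_{n+1}$ for all $n$); (O3) $x'\ll x$ and $y'\ll y$ imply $x'+y'\ll x+y$; (O4) $\sup_n x_n+\sup_n y_n=\sup_n(x_n+y_n)$ for increasing sequences $(x_n)_n,(y_n)_n$. A $\mathrm{Cu}$-morphism is an order-preserving monoid morphism between $\mathrm{Cu}$-semigroups that preserves suprema of increasing sequences and the way-below relation. Approximation (with $\mathbb{N}=\{0,1,2,\ldots\}$): a family $(S_\lambda,\varphi_\lambda)_{\lambda\in\Lambda}$ of $\mathrm{Cu}$-semigroups $S_\lambda$ and $\mathrm{Cu}$-morphisms $\varphi_\lambda\colon S_\lambda\to S$ approximates $S$ if the following holds: given finite sets $J$ and $K$, elements $x_j',x_j\in S$ for $j\in J$, and functions $m_k,n_k\colon J\to\mathbb{N}$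 for $k\in K$, such that $x_j'\ll x_j$ for all $j\in J$ and $\sum_{j\in J}m_k(j)x_j\ll\sum_{j\in J}n_k(j)x_j'$ for all $k\in K$, there exist $\lambda\in\Lambda$ and $y_j\in S_\lambda$ for $j\in J$ such that $x_j'\ll\varphi_\lambda(y_j)\ll x_j$ for each $j\in J$, and $\sum_{j\in J}m_k(j)y_j\ll\sum_{j\in J}n_k(j)y_j$ for all $k\in K$. Dimension: for a $\mathrm{Cu}$-semigroup $S$ and $n\in\mathbb{N}$, write $\dim(S)\leq n$ if, whenever $x'\ll x\ll y_1+\ldots+y_r$ in $S$, there exist $z_{j,k}\in S$ for $j=1,\ldots,r$ and $k=0,\ldots,n$ such that (i) $z_{j,k}\ll y_j$ for all $j,k$; (ii) $x'\ll\sum_{j,k}z_{j,k}$; (iii) $\sum_{j=1}^r z_{j,k}\ll x$ for each $k=0,\ldots,n$. Then $\dim(S)$ is the smallest such $n$, and $\dim(S)=\infty$ if no such $n$ exists. *)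

(* Defs.v *)
From HB Require Import structures.
From mathcomp Require Import all_boot all_order all_algebra.
From mathcomp Require Import boolp classical_sets reals ereal.

Set Implicit Arguments.
Unset Strict Implicit.
Unset Printing Implicit Defensive.

Import GRing.Theory.

Local Open Scope classical_set_scope.
Local Open Scope ring_scope.

(* The library's hierarchy has no join of [porderType] and [nmodType] below   *)
(* [Num.POrderedZmodule] and does not allow one to be added afterwards, so    *)
(* the order is carried by the mixin.                                         *)
HB.mixin Record Nmodule_isPositivelyOrdered S of GRing.Nmodule S := {
  pom_le : S -> S -> Prop;
  pom_refl : forall x, pom_le x x;
  pom_anti : forall x y, pom_le x y -> pom_le y x -> x = y;
  pom_trans : forall y x z, pom_le x y -> pom_le y z -> pom_le x z;
  pom_ge0 : forall x, pom_le 0 x;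
  pom_leD2r : forall z x y, pom_le x y -> pom_le (x + z) (y + z)
}.

#[short(type="pomType")]
HB.structure Definition PositivelyOrderedMonoid :=
  {S of Nmodule_isPositivelyOrdered S & GRing.Nmodule S}.

Notation "x ⊑ y" := (pom_le x y) (at level 70, y at next level).

Definition increasing (S : pomType) (z : nat -> S) : Prop :=
  forall n, z n ⊑ z n.+1.

Definition is_sup (S : pomType) (z : nat -> S) (s : S) : Prop :=
  (forall n, z n ⊑ s) /\ (forall t, (forall n, z n ⊑ t) -> s ⊑ t).

Definition way_below (S : pomType) (x y : S) : Prop :=
  forall (z : nat -> S) (s : S),
    increasing z -> is_sup z s -> y ⊑ s -> exists n, x ⊑ z n.

Notation "x ≪ y" := (way_below x y) (at level 70, y at next level).

HB.mixin Record isCuSemigroup S of PositivelyOrderedMonoid S := {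
  cu_O1 : forall z : nat -> S, increasing z -> exists s, is_sup z s;
  cu_O2 : forall x : S,
    exists z : nat -> S, (forall n, z n ≪ z n.+1) /\ is_sup z x;
  cu_O3 : forall x' x y' y : S, x' ≪ x -> y' ≪ y -> x' + y' ≪ x + y;
  cu_O4 : forall (u v : nat -> S) (a b : S), increasing u -> increasing v ->
    is_sup u a -> is_sup v b -> is_sup (fun n => u n + v n) (a + b)
}.

#[short(type="cuSemigroupType")]
HB.structure Definition CuSemigroup :=
  {S of isCuSemigroup S & PositivelyOrderedMonoid S}.

HB.mixin Record isCuMorphism (S T : cuSemigroupType) (f : S -> T) := {
  cumorph_le : forall x y : S, x ⊑ y -> f x ⊑ f y;
  cumorph_sup : forall (z : nat -> S) (s : S),
    increasing z -> is_sup z s -> is_sup (fun n => f (z n)) (f s);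
  cumorph_way_below : forall x y : S, x ≪ y -> f x ≪ f y
}.

HB.structure Definition CuMorphism (S T : cuSemigroupType) :=
  {f of isCuMorphism S T f & @GRing.Additive S T f}.

Notation "{ 'cumorphism' S -> T }" := (CuMorphism.type S T)
  (at level 0, S at level 98, T at level 99,
   format "{ 'cumorphism'  S  ->  T }") : type_scope.

Definition approximates (S : cuSemigroupType) (L : Type)
    (S_ : L -> cuSemigroupType) (phi : forall l, {cumorphism S_ l -> S}) :
    Prop :=
  forall (J K : finType) (x' x : J -> S) (m n : K -> J -> nat),
    (forall j, x' j ≪ x j) ->
    (forall k, \sum_j x j *+ m k j ≪ \sum_j x' j *+ n k j) ->
  exists (l : L) (y : J -> S_ l),
    (forall j, x' j ≪ phi l (y j) /\ phi l (y j) ≪ x j) /\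
    (forall k, \sum_j y j *+ m k j ≪ \sum_j y j *+ n k j).

Definition cu_dim_le (S : cuSemigroupType) (n : nat) : Prop :=
  forall (r : nat) (x' x : S) (y : 'I_r -> S),
    x' ≪ x -> x ≪ \sum_j y j ->
  exists z : 'I_r -> 'I_n.+1 -> S,
    [/\ forall j k, z j k ≪ y j,
        x' ≪ \sum_j \sum_k z j k &
        forall k, \sum_j z j k ≪ x].

(* The least [n] with [cu_dim_le S n], as an extended real so that the value  *)
(* oo and suprema of dimensions are those of [\bar R].                        *)
Definition cu_dim (R : realType) (S : cuSemigroupType) : \bar R :=
  if pselect (exists n, `[< cu_dim_le S n >]) is left h
  then ((ex_minn h)%:R)%:E else +oo%E.

(* Main.v *)
Require Import Defs.
From HB Require Import structures.
From mathcomp Require Import all_boot all_order all_algebra.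
From mathcomp Require Import boolp classical_sets reals ereal.

Set Implicit Arguments.
Unset Strict Implicit.
Unset Printing Implicit Defensive.

Import Order.TTheory GRing.Theory Num.Theory.

Local Open Scope classical_set_scope.
Local Open Scope ring_scope.

(** If all [S_ l] have dimension at most [n], so does [S]; the inequality of
    extended reals reduces to this because the dimensions are natural numbers,
    so that a finite supremum can be replaced by its integral part.

    Let [x' ≪ x ≪ y_1 + ... + y_r] in [S].  The data [x ≪ y_1 + ... + y_r] is
    transported to some [S_ l] by the approximation property, but the latter
    takes as input a relation whose right-hand side is formed from elements
    strictly way below the [y_j]: such [y'_j ≪ y_j] with
    [x ≪ y'_1 + ... + y'_r] exist because, by (O2) and (O4), the sum is a
    supremum of sums of that form ([way_below_sum_interpolation]).  Choosing
    also [s] with [x' ≪ s ≪ x], one obtains [a] and [b_j] in [S_ l] with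
    [s ≪ phi a ≪ x], [phi b_j ≪ y_j] and [a ≪ b_1 + ... + b_r].  The dimension
    condition in [S_ l] still needs an element [a' ≪ a], and it must be large
    enough that [x' ≪ phi a'].  As [phi] preserves the supremum of a
    [≪]-increasing sequence with supremum [a], some member of that sequence
    will do ([cumorph_interpolation]).  The elements of [S_ l] that witness the
    dimension condition for [a' ≪ a ≪ b_1 + ... + b_r] are mapped by [phi] to
    the required elements of [S]. *)

(** * The way-below relation *)

Lemma is_sup_cst (S : pomType) (x : S) : is_sup (fun=> x) x.
Proof. by split=> [_|t /(_ 0%N)//]; apply: pom_refl. Qed.

Lemma way_below_le (S : pomType) (x y : S) : x ≪ y -> x ⊑ y.
Proof.
have yI : increasing (fun=> y) by move=> _; apply: pom_refl.
by move=> /(_ _ _ yI (is_sup_cst y) (pom_refl y))[].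
Qed.

Lemma way_below_le_trans (S : pomType) (y x z : S) : x ≪ y -> y ⊑ z -> x ≪ z.
Proof. by move=> xy yz u s uI us /(pom_trans _ _ _ yz); apply: xy. Qed.

Lemma le_way_below_trans (S : pomType) (y x z : S) : x ⊑ y -> y ≪ z -> x ≪ z.
Proof.
move=> xy yz u s uI us zs; have [n yu] := yz u s uI us zs.
by exists n; exact: pom_trans _ _ _ xy yu.
Qed.

Lemma way_below_trans (S : pomType) (y x z : S) : x ≪ y -> y ≪ z -> x ≪ z.
Proof. by move=> /way_below_le; apply: le_way_below_trans. Qed.

Lemma way_below0 (S : pomType) (x : S) : 0 ≪ x.
Proof. by move=> u s _ _ _; exists 0%N; apply: pom_ge0. Qed.

Lemma way_below_increasing (S : pomType) (z : nat -> S) :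
  (forall n, z n ≪ z n.+1) -> increasing z.
Proof. by move=> zI n; apply: way_below_le. Qed.

Lemma way_below_sup (S : pomType) (z : nat -> S) (s : S) n :
  (forall n, z n ≪ z n.+1) -> is_sup z s -> z n ≪ s.
Proof. by move=> zI [zs _]; apply: way_below_le_trans (zI n) (zs _). Qed.

Lemma way_below_interpolation (S : cuSemigroupType) (x y : S) :
  x ≪ y -> exists w, x ≪ w /\ w ≪ y.
Proof.
have [z [zI zy]] := cu_O2 y.
move=> /(_ z y (way_below_increasing zI) zy (pom_refl y))[n xz].
exists (z n.+1); split; first exact: le_way_below_trans xz (zI n).
exact: way_below_sup zI zy.
Qed.

Lemma is_sup_sum (S : cuSemigroupType) (r : nat) (u : 'I_r -> nat -> S)
    (y : 'I_r -> S) :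
  (forall j, increasing (u j)) -> (forall j, is_sup (u j) (y j)) ->
  increasing (fun n => \sum_j u j n) /\
  is_sup (fun n => \sum_j u j n) (\sum_j y j).
Proof.
elim: r u y => [|r IHr] u y uI uy.
  have -> : (fun n => \sum_j u j n) = fun=> 0.
    by apply/funext => n; rewrite big_ord0.
  rewrite big_ord0; split; last exact: is_sup_cst.
  by move=> n; apply: pom_refl.
have [vI vs] := IHr _ _ (fun j => uI (lift ord0 j)) (fun j => uy (lift ord0 j)).
have -> : (fun n => \sum_j u j n) =
    fun n => u ord0 n + \sum_j u (lift ord0 j) n.
  by apply/funext => n; rewrite big_ord_recl.
rewrite big_ord_recl; split; last exact: cu_O4.
move=> n; apply: pom_trans _ _ _ (pom_leD2r _ _ _ (uI ord0 n)) _.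
by rewrite ![u ord0 n.+1 + _]addrC; apply: pom_leD2r.
Qed.

(** The sum is the supremum of the sums of the [n]-th terms of
    [≪]-increasing sequences with suprema [y j]. *)
Lemma way_below_sum_interpolation (S : cuSemigroupType) (r : nat) (x : S)
    (y : 'I_r -> S) :
  x ≪ \sum_j y j ->
  exists y' : 'I_r -> S, (forall j, y' j ≪ y j) /\ x ≪ \sum_j y' j.
Proof.
move=> /way_below_interpolation[w [xw wy]].
have [u uP] := choice (fun j => cu_O2 (y j)).
have [uI us] := is_sup_sum (fun j => way_below_increasing (uP j).1)
  (fun j => (uP j).2).
have [n wu] := wy _ _ uI us (pom_refl _).
exists (u ^~ n); split; last exact: way_below_le_trans xw wu.
by move=> j; have [ujI ujy] := uP j; apply: way_below_sup ujI ujy.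
Qed.

(** A Cu-morphism maps a [≪]-increasing sequence with supremum [a] to a
    sequence with supremum [f a], whose members eventually exceed any element
    way below [f a]. *)
Lemma cumorph_interpolation (S T : cuSemigroupType) (f : {cumorphism S -> T})
    (s : T) (a : S) :
  s ≪ f a -> exists a', a' ≪ a /\ s ⊑ f a'.
Proof.
move=> sa; have [u [uI ua]] := cu_O2 a.
have uI' := way_below_increasing uI.
have fuI : increasing (fun n => f (u n)).
  by move=> n; apply: cumorph_le; apply: uI'.
have [n su] := sa _ _ fuI (cumorph_sup _ _ uI' ua) (pom_refl _).
by exists (u n); split=> //; apply: way_below_sup uI ua.
Qed.

(** * Dimension as a natural number *)

(** Zero is way below everything, so a superfluous index [k] is filled with
    zeros. *)
Lemma cu_dim_leS (S : cuSemigroupType) (n : nat) :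
  cu_dim_le S n -> cu_dim_le S n.+1.
Proof.
move=> Sn r x' x y x'x xy; have [z [zy x'z zx]] := Sn r x' x y x'x xy.
exists (fun j k => if unlift ord0 k is Some k' then z j k' else 0); split.
- by move=> j k; case: unliftP => [k' _|_]; [apply: zy | apply: way_below0].
- apply: way_below_le_trans x'z _.
  under [X in _ ⊑ X]eq_bigr => j _.
    rewrite big_ord_recl unlift_none add0r.
    under eq_bigr => k _ do rewrite liftK.
    over.
  exact: pom_refl.
- move=> k; case: unliftP => [k' _|_]; first exact: zx.
  by rewrite big1 //; apply: way_below0.
Qed.

Lemma cu_dim_le_leq (S : cuSemigroupType) (m n : nat) :
  (m <= n)%N -> cu_dim_le S m -> cu_dim_le S n.
Proof.
move=> /subnK <- Sm; elim: (n - m)%N => [//|k IHk].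
by rewrite addSn; apply: cu_dim_leS.
Qed.

Lemma cu_dim_leP (R : realType) (S : cuSemigroupType) (n : nat) :
  (cu_dim R S <= n%:R%:E)%E <-> cu_dim_le S n.
Proof.
rewrite /cu_dim; case: pselect => [h|Soo]; last first.
  by split=> // Sn; case: Soo; exists n; apply/asboolP.
case: ex_minnP => m /asboolP Sm m_min; rewrite lee_fin ler_nat.
by split=> [/cu_dim_le_leq|/asboolP]; [apply | apply: m_min].
Qed.

Lemma cu_dim_ge0 (R : realType) (S : cuSemigroupType) : (0 <= cu_dim R S)%E.
Proof.
by rewrite /cu_dim; case: pselect => // h; rewrite lee_fin ler0n.
Qed.

(** Being a natural number, the dimension is bounded by the integral part of
    any finite bound. *)
Lemma cu_dim_le_truncn (R : realType) (S : cuSemigroupType) (x : R) :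
  (cu_dim R S <= x%:E)%E -> cu_dim_le S (Num.truncn x).
Proof.
move=> Sx; apply/(cu_dim_leP R); move: Sx; rewrite /cu_dim.
case: pselect => // h; rewrite !lee_fin ler_nat => mx.
by rewrite -[leqLHS](@natrK R) le_truncn.
Qed.

(** * Approximation *)

Lemma approximates_inhabited (S : cuSemigroupType) (L : Type)
    (S_ : L -> cuSemigroupType) (phi : forall l : L, {cumorphism S_ l -> S}) :
  approximates phi -> inhabited L.
Proof.
move=> /(_ void void (fun=> 0) (fun=> 0) (fun=> fun=> 0%N) (fun=> fun=> 0%N)).
by case=> [[]|[]|l _]; exists.
Qed.

(** The instance of the approximation property that concerns a single relation
    [x ≪ \sum_j y j]. *)
Lemma approximates_sum (S : cuSemigroupType) (L : Type)
    (S_ : L -> cuSemigroupType) (phi : forall l : L, {cumorphism S_ l -> S})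
    (r : nat) (s x : S) (y : 'I_r -> S) :
  approximates phi -> s ≪ x -> x ≪ \sum_j y j ->
  exists (l : L) (a : S_ l) (b : 'I_r -> S_ l),
    [/\ s ≪ phi l a, phi l a ≪ x, forall j, phi l (b j) ≪ y j &
        a ≪ \sum_j b j].
Proof.
move=> Sphi sx /way_below_sum_interpolation[y' [y'y xy']].
(* The index [inl tt] stands for [x] and [inr j] for [y j]; the coefficients
   [m] and [n] select [x] on the left and the [y' j] on the right. *)
pose J : finType := (unit + 'I_r)%type.
pose sel (T : Type) (x0 : T) (y0 : 'I_r -> T) (i : J) : T :=
  match i with inl _ => x0 | inr j => y0 j end.
pose m := sel nat 1%N (fun=> 0%N).
pose n := sel nat 0%N (fun=> 1%N).
have sum_m (T : cuSemigroupType) (c : J -> T) :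
    \sum_i c i *+ m i = c (inl tt).
  rewrite big_sumType /= (big_pred1 tt); last by case.
  by rewrite big1 ?addr0.
have sum_n (T : cuSemigroupType) (c : J -> T) :
    \sum_i c i *+ n i = \sum_j c (inr j).
  by rewrite big_sumType /= big1 ?add0r.
have [||l [c [c_between c_rel]]] := Sphi J unit
  (sel S s y') (sel S x y) (fun=> m) (fun=> n).
- by case.
- by move=> _; rewrite sum_m sum_n.
exists l, (c (inl tt)), (fun j => c (inr j)); split.
- by have [] := c_between (inl tt).
- by have [] := c_between (inl tt).
- by move=> j; have [] := c_between (inr j).
- by have := c_rel tt; rewrite sum_m sum_n.
Qed.

Lemma approximates_dim_le (S : cuSemigroupType) (L : Type)
    (S_ : L -> cuSemigroupType) (phi : forall l : L, {cumorphism S_ l -> S})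
    (n : nat) :
  approximates phi -> (forall l, cu_dim_le (S_ l) n) -> cu_dim_le S n.
Proof.
move=> Sphi S_n r x' x y /way_below_interpolation[s [x's sx]] xy.
have [l [a [b [sa ax bP ab]]]] := approximates_sum Sphi sx xy.
have [a' [a'a sa']] := cumorph_interpolation sa.
have [c [cb a'c ca]] := S_n l r a' a b a'a ab.
exists (fun j k => phi l (c j k)); split.
- by move=> j k; apply: way_below_trans (cumorph_way_below _ _ (cb j k)) (bP j).
- have -> : \sum_j \sum_k phi l (c j k) = phi l (\sum_j \sum_k c j k).
    by rewrite raddf_sum; apply: eq_bigr => j _; rewrite raddf_sum.
  apply: way_below_trans (cumorph_way_below _ _ a'c).
  exact: way_below_le_trans x's sa'.
- move=> k; rewrite -raddf_sum.
  exact: way_below_trans (cumorph_way_below _ _ (ca k)) ax.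
Qed.

Theorem proposition3p4 (R : realType) (S : cuSemigroupType) (L : Type)
    (S_ : L -> cuSemigroupType) (phi : forall l : L, {cumorphism S_ l -> S}) :
  approximates phi ->
  (cu_dim R S <= ereal_sup (range (fun l : L => cu_dim R (S_ l))))%E.
Proof.
move=> Sphi; set D := range _; have [l0] := approximates_inhabited Sphi.
have D_ub l : (cu_dim R (S_ l) <= ereal_sup D)%E.
  by apply: ereal_sup_ubound; exists l.
have := le_trans (cu_dim_ge0 R (S_ l0)) (D_ub l0).
case: (ereal_sup D) D_ub => [x D_ub x_ge0|_ _|//]; last exact: leey.
have Sn : cu_dim_le S (Num.truncn x).
  by apply: approximates_dim_le Sphi _ => l; apply: cu_dim_le_truncn.
apply: le_trans ((cu_dim_leP R S _).2 Sn) _.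
by rewrite lee_fin truncn_le.
Qed.
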